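(* Let $X$ be an ${\uparrow}{\downarrow}$-closed topologized poset. Then $X$ is complete if and only if $X$ is chain-compact.
   Context: A topologized poset is a partially ordered set $(X,\le)$ endowed with a topology (no compatibility between order and topology is assumed). $\overline{A}$ denotes the closure of $A$. Put ${\uparrow}x=\{y\in X:x\le y\}$ and ${\downarrow}x=\{y\in X:y\le x\}$. A topologized poset $X$ is ${\uparrow}{\downarrow}$-closed if for every $x\in X$ both sets ${\uparrow}x$ and ${\downarrow}x$ are closed in $X$. A chain is a subset any two elements of which are comparable. $X$ is chain-compact if each closed chain in $X$ is compact (every open cover has a finite subcover; no separation axiom is included). A subset $D\subseteq X$ is up-directed (resp. down-directed) if for any $x,y\in D$ there is $z\in D$ with $x\le z$ and $y\le z$ (resp. $z\le x$ and $z\le y$). $X$ is complete if each nonempty up-directed set $D\subseteq X$ has a least upper bound $\sup D$ in $X$ with $\sup D\in\overline{D}$, and each nonempty down-directed set $D\subseteq X$ has a greatest lower bound $\inf D$ in $X$ with $\inf D\in\overline{D}$. *)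

(* Defs.v *)
From HB Require Import structures.
From mathcomp Require Import all_boot all_order.
From mathcomp Require Import boolp classical_sets filter topology.

Set Implicit Arguments.
Unset Strict Implicit.
Unset Printing Implicit Defensive.

Import Order.TTheory.

Local Open Scope classical_set_scope.
Local Open Scope order_scope.

Section Posets.
Variables (d : Order.disp_t) (X : porderType d).

Definition upset (x : X) : set X := [set y | x <= y].
Definition downset (x : X) : set X := [set y | y <= x].

Definition chain (C : set X) : Prop := total_on C (fun x y : X => x <= y).

Definition up_directed (D : set X) : Prop :=
  forall x y, D x -> D y -> exists z, [/\ D z, x <= z & y <= z].

Definition down_directed (D : set X) : Prop :=
  forall x y, D x -> D y -> exists z, [/\ D z, z <= x & z <= y].

End Posets.

(* [POrderedTopological.type d] is a bare join of a partial order and a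
   topology: it carries no compatibility axiom between them. *)
Section TopologizedPosets.
Variables (d : Order.disp_t) (X : POrderedTopological.type d).

Definition updown_closed : Prop :=
  forall x : X, closed (upset x) /\ closed (downset x).

Definition chain_compact : Prop :=
  forall C : set X, chain C -> closed C -> cover_compact C.

Definition complete_tposet : Prop :=
  (forall D : set X, D !=set0 -> up_directed D ->
     exists2 s, supremums D s & closure D s) /\
  (forall D : set X, D !=set0 -> down_directed D ->
     exists2 i, infimums D i & closure D i).

End TopologizedPosets.

Arguments updown_closed {d} X.
Arguments chain_compact {d} X.
Arguments complete_tposet {d} X.

(* Main.v *)
(* From completeness to compactness: on a closed chain C of a complete poset,
   every nonempty part has its supremum and infimum in its closure, so an open
   set around s contains a one-sided order interval at s (otherwise s would be
   the supremum, resp. infimum, of points outside that open set).  The usual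
   creeping argument for the compactness of [0, 1] then applies.

   Conversely, the closure of a chain is a chain, so its compactness gives each
   nonempty chain a supremum in its closure.  To pass from chains to a directed
   set D (Iwamura), fix a monotone map h from the finite subsets of D to D with
   h F an upper bound of F, and put E A := {h F | F finite, F <= A}.  Zorn's
   lemma applies to the sets A <= D such that E (A U F) has a supremum in the
   closure of D for every finite F <= D, and a maximal such A is all of D. *)
Require Import Defs.
From mathcomp Require Import all_boot all_order.
From mathcomp Require Import finmap.
From mathcomp Require Import boolp classical_sets filter topology.

Set Implicit Arguments.
Unset Strict Implicit.
Unset Printing Implicit Defensive.

Import Order.TTheory.

Local Open Scope classical_set_scope.

(** * Finite subsets of directed sets *)

(** Serves twice: to bound finitely many points of a directed set, and to place a finite part of the
    union of a chain of sets inside one member. *)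
Lemma directed_seq (I : eqType) (U : Type) (G : set U) (P : I -> U -> Prop) :
  G !=set0 ->
  (forall a b, G a -> G b ->
    exists2 c, G c & forall i, P i a \/ P i b -> P i c) ->
  forall s : seq I, (forall i, i \in s -> exists2 a, G a & P i a) ->
    exists2 a, G a & forall i, i \in s -> P i a.
Proof.
move=> [g Gg] dir; elim=> [_|i s IH sP]; first by exists g.
have [|a Ga sa] := IH; first by move=> j js; apply: sP; rewrite inE js orbT.
have [b Gb ib] := sP _ (mem_head i s).
have [c Gc abc] := dir _ _ Ga Gb.
exists c => // j; rewrite inE => /orP[/eqP->|js]; apply: abc; first by right.
by left; exact: sa.
Qed.

Section Relation.
Variables (T : choiceType) (R : T -> T -> Prop).
Hypothesis Rxx : forall x, R x x.
Hypothesis Rtrans : forall y x z, R x y -> R y z -> R x z.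

(** The relation is abstract so that infima are obtained as suprema for the reversed order. *)
Definition lub (A : set T) (s : T) : Prop :=
  (forall x, A x -> R x s) /\ (forall b, (forall x, A x -> R x b) -> R s b).

Definition directed (D : set T) : Prop :=
  forall x y, D x -> D y -> exists2 z, D z & R x z /\ R y z.

Lemma directed_ub (D : set T) (s : seq T) : D !=set0 -> directed D ->
  (forall x, x \in s -> D x) -> exists2 u, D u & forall x, x \in s -> R x u.
Proof.
move=> D0 Ddir sD; apply: directed_seq => //.
- move=> a b Da Db; have [c Dc [ac bc]] := Ddir _ _ Da Db.
  by exists c => // x [xa|xb]; [exact: Rtrans xa ac|exact: Rtrans xb bc].
- by move=> x /sD Dx; exists x.
Qed.

(** By recursion on cardinality, [h F] is a chosen upper bound in [D] of [F] together with all [h G]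
    for [G] a proper subset of [F]. *)
Lemma monotone_ub (D : set T) : D !=set0 -> directed D ->
  exists h : {fset T} -> T, forall F : {fset T}, [set` F] `<=` D ->
    [/\ D (h F), forall x, x \in F -> R x (h F) &
        forall G : {fset T}, (G `<=` F)%fset -> R (h G) (h F)].
Proof.
move=> D0 Ddir.
have [ub ubP] : exists ub : seq T -> T, forall s, (forall x, x \in s -> D x) ->
    D (ub s) /\ forall x, x \in s -> R x (ub s).
  suff /choice[ub ubP] : forall s : seq T, exists u,
      (forall x, x \in s -> D x) -> D u /\ forall x, x \in s -> R x u.
    by exists ub.
  move=> s; have [sD|nsD] := pselect (forall x, x \in s -> D x).
    by have [u Du su] := directed_ub D0 Ddir sD; exists u.
  by have [u _] := D0; exists u => /nsD.
(* [H n] is the intended map on the sets with less than [n] elements. *)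
pose proper (F : {fset T}) := [seq G <- fpowerset F | G != F].
pose fix H (n : nat) (F : {fset T}) {struct n} : T := if n is m.+1 then ub (enum_fset F ++ map (H m) (proper F))
                  else ub [::].
have properP F G : (G \in proper F) = (G `<` F)%fset.
  by rewrite mem_filter fpowersetE fproperEneq.
have HE n F : H n.+1 F = ub (enum_fset F ++ map (H n) (proper F)) by [].
have H_fuel n m F : #|` F| < n -> #|` F| < m -> H n F = H m F.
  elim: n m F => // n IH [//|m] F Fn Fm; rewrite !HE; congr (ub (_ ++ _)).
  apply/eq_in_map => G; rewrite properP => /fproper_ltn_card GF.
  by apply: IH; exact: leq_trans GF _.
have HD n F : [set` F] `<=` D -> D (H n F).
  elim: n F => [|n IH] F FD; first by have [] := ubP [::].
  rewrite HE; apply: (proj1 (ubP _ _)) => x; rewrite mem_cat => /orP[/FD//|].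
  move=> /mapP[G]; rewrite properP => /fproper_sub/fsubsetP GF ->.
  by apply: IH => y /GF /FD.
exists (fun F => H #|` F|.+1 F) => F FD.
have ubF : forall x, x \in enum_fset F ++ map (H #|` F|) (proper F) ->
    R x (H #|` F|.+1 F).
  rewrite HE; apply: (proj2 (ubP _ _)) => x; rewrite mem_cat => /orP[/FD//|].
  move=> /mapP[G]; rewrite properP => /fproper_sub/fsubsetP GF ->.
  by apply: HD => y /GF /FD.
split; first exact: HD.
  by move=> x xF; apply: ubF; rewrite mem_cat xF.
move=> G; rewrite fsubEproper => /orP[/eqP->//|GF].
apply: ubF; rewrite mem_cat; apply/orP; right.
(* The recursion evaluates [G] with fuel [#|] F|[, while]h G[uses]#|[G|.+1]; both exceed the
   cardinal of [G], so the values agree. *)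
rewrite (@H_fuel _ #|` F| G) ?ltnS ?fproper_ltn_card//.
by apply: map_f; rewrite properP.
Qed.

End Relation.

(** * Suprema of chains and of directed sets *)

Lemma closure_sub_closed (T : topologicalType) (A B : set T) :
  closed B -> A `<=` B -> closure A `<=` B.
Proof. by move=> /closure_id BE /closureS; rewrite -BE. Qed.

Section TopologizedRelation.
Variables (T : topologicalType) (R : T -> T -> Prop).
Hypothesis Rxx : forall x, R x x.
Hypothesis Rtrans : forall y x z, R x y -> R y z -> R x z.
Hypothesis closed_above : forall x, closed [set y | R x y].
Hypothesis closed_below : forall x, closed [set y | R y x].
Hypothesis chain_cover_compact :
  forall C : set T, total_on C R -> closed C -> cover_compact C.

(** The points comparable to a given one form a closed set; this is used once for each of the two
    points. *)
Lemma closure_chain (C : set T) : total_on C R -> total_on (closure C) R.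
Proof.
have comparable_closed x : closed ([set y | R x y] `|` [set y | R y x]).
  by apply: closedU.
move=> Ctot x y clx cly.
apply: (closure_sub_closed (comparable_closed x) _ cly) => z Cz.
have zC : C `<=` [set y | R z y] `|` [set y | R y z] by move=> w; exact: Ctot.
by have [xz|zx] := closure_sub_closed (comparable_closed z) zC clx; [right|left].
Qed.

(** An upper bound of [C] in its closure is least, since lower cones are closed. If there were none,
    the complements of the upper cones of points of [C] would cover the closure; but an upper bound
    in [C] of the finitely many indices of a subcover escapes it. *)
Lemma chain_lub (C : set T) : C !=set0 -> total_on C R ->
  exists2 s, lub R C s & closure C s.
Proof.
move=> C0 Ctot.
have Cco := chain_cover_compact (closure_chain Ctot) (@closed_closure _ C).
suff [u clu Cu] : exists2 u, closure C u & forall x, C x -> R x u.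
  exists u => //; split=> // b Cb.
  exact: (closure_sub_closed (@closed_below b) Cb clu).
apply: contrapT => noub.
have [||F FC cov] := Cco T C (fun c => ~` [set y | R c y]).
- by move=> c _; exact: closed_openC.
- move=> u clu; apply: contrapT => nu; apply: noub; exists u => // x Cx.
  by apply: contrapT => nxu; apply: nu; exists x.
have [||c Cc Fc] := @directed_ub T R Rxx Rtrans C (enum_fset F) C0.
- move=> x y Cx Cy.
  by have [xy|yx] := Ctot _ _ Cx Cy; [exists y|exists x].
- by move=> x /FC /set_mem.
by have [x xF] := cov c (subset_closure Cc); apply; exact: Fc.
Qed.

Lemma directed_lub (D : set T) : D !=set0 -> directed R D ->
  exists2 s, lub R D s & closure D s.
Proof.
move=> D0 Ddir; have [h hP] := monotone_ub Rxx Rtrans D0 Ddir.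
pose E (A : set T) := h @` [set F : {fset T} | [set` F] `<=` A].
have ES A B : A `<=` B -> E A `<=` E B.
  by move=> AB _ [F FA <-]; exists F => // x /FA /AB.
pose good A := exists2 s, lub R (E A) s & closure D s.
(* Quantifying over [F] lets a maximal [A] absorb a new point [x]: adjoining [F] to [A] with [x] is
   adjoining a finite set to [A]. *)
pose P (A : set T) := A `<=` D /\
  forall F : {fset T}, [set` F] `<=` D -> good (A `|` [set` F]).
have good_fset (F : {fset T}) : [set` F] `<=` D -> good [set` F].
  move=> FD; have [DhF _ hF] := hP F FD.
  exists (h F); last exact: subset_closure.
  split=> [_ [G GF <-]|b]; first by apply: hF; apply/fsubsetP.
  by apply; exists F.
have [|A [[AD PA] Amax]] := @Zorn_bigcup T P.
  move=> G GP Gtot; split=> [x [A GA]|F FD]; first exact: (GP A GA).1.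
  (* For the empty chain only [F] remains, and [h F] is the greatest element of [E F]. *)
  have [G0|/set0P Gn0] := eqVneq G set0.
    by rewrite G0 bigcup_set0 set0U; exact: good_fset.
  (* As [E] is monotone, the suprema attached to the members of [G] form a chain; its supremum is
     the one for the union. *)
  pose K := [set s | exists2 A, G A & lub R (E (A `|` [set` F])) s /\ closure D s].
  have Kin A : G A ->
      exists2 s, K s & forall x, E (A `|` [set` F]) x -> R x s.
    move=> GA; have [s ls cs] := (GP A GA).2 F FD.
    by exists s; [exists A|exact: ls.1].
  have K0 : K !=set0.
    by have [A GA] := Gn0; have [s Ks _] := Kin A GA; exists s.
  have Ktot : total_on K R.
    move=> s t [A GA [[sE sl] _]] [B GB [[tE tl] _]].
    have [AB|BA] := Gtot _ _ GA GB; [left; apply: sl|right; apply: tl].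
    - by move=> x xA; apply: tE; apply: ES x xA; exact: setSU.
    - by move=> x xB; apply: sE; apply: ES x xB; exact: setSU.
  have [s [sK sl] cs] := chain_lub K0 Ktot.
  exists s; last first.
    by apply: (closure_sub_closed (@closed_closure _ D)) cs => x [A _ []].
  split=> [_ [F' F'GF <-]|b Eb].
    have [||A GA F'A] :=
      @directed_seq _ _ G (fun x A => (A `|` [set` F]) x) Gn0 _ (enum_fset F').
    - move=> A B GA GB; have [AB|BA] := Gtot _ _ GA GB.
        by exists B => // x [|//]; exact: setSU.
      by exists A => // x [//|]; exact: setSU.
    - move=> x /F'GF[[A GA Ax]|Fx]; first by exists A => //; left.
      by have [A GA] := Gn0; exists A => //; right.
    have [t Kt tE] := Kin A GA.
    by apply: Rtrans (sK t Kt); apply: tE; exists F'.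
  apply: sl => t [A GA [[_ tl] _]]; apply: tl => x Ex; apply: Eb.
  by apply: ES x Ex; apply: setSU; exact: bigcup_sup.
have DA : D `<=` A.
  move=> x Dx; apply: contrapT => nAx.
  apply: (Amax (A `|` [set` [fset x]%fset])).
    split; first exact: subsetUl.
    by move=> /(_ x) H; apply/nAx/H; right => /=; rewrite inE.
  have xD : [set` [fset x]%fset] `<=` D by move=> y /=; rewrite inE => /eqP ->.
  split=> [y [/AD//|/xD//]|F FD].
  have := PA ([fset x] `|` F)%fset; rewrite set_fsetU setUA; apply.
  by move=> y [/xD|/FD].
have [|s [sE sl] cs] := PA fset0; first by move=> x /=; rewrite inE.
(* [E A] lies in [D] and is cofinal there, as [x] is below the value of [h] at its singleton; hence
   both have the same supremum. *)
have DE x : D x -> exists2 y, E A y & R x y.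
  move=> Dx; have xD : [set` [fset x]%fset] `<=` D.
    by move=> y /=; rewrite inE => /eqP ->.
  have [_ xh _] := hP _ xD; exists (h [fset x]%fset); last by apply: xh; rewrite inE.
  by exists [fset x]%fset => // y /xD /DA.
have AE : A `|` [set` fset0] `<=` A by move=> x [//|/=]; rewrite inE.
exists s => //; split=> [x /DE[y Ey xy]|b Db].
  by apply: Rtrans xy _; apply: sE; apply: ES y Ey; exact: subsetUl.
apply: sl => _ [F FA <-]; apply: Db.
by have [] := hP F (subset_trans (subset_trans FA AE) AD).
Qed.

End TopologizedRelation.

(** * The two implications *)

Section Completeness.
Variables (d : Order.disp_t) (X : POrderedTopological.type d).
Local Open Scope order_scope.

Lemma complete_chain_compact : complete_tposet X -> chain_compact X.
Proof.
move=> [Xsup Xinf] C Ctot Ccl I D f fo Cf.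
have CclS (A : set X) : A `<=` C -> closure A `<=` C.
  exact: closure_sub_closed.
have Csup (A : set X) : A !=set0 -> A `<=` C ->
    exists2 s, supremums A s & closure A s.
  move=> A0 AC; apply: Xsup => // x y Ax Ay.
  by have [xy|yx] := Ctot _ _ (AC _ Ax) (AC _ Ay); [exists y|exists x].
have Cinf (A : set X) : A !=set0 -> A `<=` C ->
    exists2 s, infimums A s & closure A s.
  move=> A0 AC; apply: Xinf => // x y Ax Ay.
  by have [xy|yx] := Ctot _ _ (AC _ Ax) (AC _ Ay); [exists x|exists y].
have Cnle x y : C x -> C y -> ~ x <= y -> y <= x.
  by move=> Cx Cy nxy; have [] := Ctot _ _ Cx Cy.
have clf (A : set X) i x : D i -> closure A x -> f i x -> exists2 y, A y & f i y.
  move=> Di clx fx; have [|y [Ay fy]] := clx (f i); last by exists y.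
  by apply: open_nbhs_nbhs; split=> //; exact: fo.
pose FC := finite_subset_cover D f.
have FCS (A B : set X) : A `<=` B -> FC B -> FC A.
  by move=> AB [J JD BJ]; exists J => // x /AB /BJ.
have FCU (A B : set X) : FC A -> FC B -> FC (A `|` B).
  move=> [J JD AJ] [K KD BK]; exists (J `|` K)%fset.
    by move=> i; rewrite inE => /orP[/JD|/KD].
  by move=> x [/AJ|/BK] [i Ji fx]; exists i => //=; rewrite inE Ji ?orbT.
have FC1 i : D i -> FC (f i).
  move=> Di; exists [fset i]%fset; first by move=> j /fset1P ->; exact/mem_set.
  by move=> x fx; exists i => //=; rewrite inE.
pose L x := C `&` [set y | y <= x].
pose S := [set x | C x /\ FC (L x)].
have [C0|/set0P Cn0] := eqVneq C set0.
  by exists fset0 => // x; rewrite C0.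
have SC : S `<=` C by move=> x [].
have S0 : S !=set0.
  have [m [mC _] /(CclS _ (@subset_refl _ C)) Cm] := Cinf C Cn0 (@subset_refl _ C).
  have [i Di fm] := Cf m Cm; exists m; split=> //.
  apply: FCS (FC1 i Di) => x [Cx /= xm].
  by rewrite (_ : x = m)//; apply: le_anti; rewrite xm mC.
have [s [Ss sl] cs] := Csup S S0 SC.
have Cs : C s by exact: CclS cs.
have [i Di fs] := Cf s Cs.
have {Ss sl cs} [FCs sS] : FC (L s) /\ ubound S s.
  (* If [a], the supremum of [A], were above [s], it would equal [s], and [f i] would meet [A]. So
     some [x] in [S] is not below [a], hence bounds [A], and [L s] is covered by [L x] and [f i]. *)
  split=> //; pose A := L s `\` f i.
  have LA (x : X) : (forall y, A y -> y <= x) -> C x -> L s `<=` L x `|` f i.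
    move=> Ax Cx y [Cy ys]; have [fy|nfy] := pselect (f i y); first by right.
    by left; split=> //; apply: Ax.
  have AC : A `<=` C by move=> x [[]].
  have [A0|/set0P An0] := eqVneq A set0.
    have [x Sx] := S0; apply: FCS (LA x _ (SC _ Sx)) (FCU _ _ Sx.2 (FC1 _ Di)).
    by move=> y; rewrite A0.
  have [a [Aa al] ca] := Csup A An0 AC.
  have Ca : C a by exact: CclS ca.
  have nas : ~ s <= a.
    move=> sa; have := clf A i a Di ca; case.
      rewrite (_ : a = s)//; apply: le_anti; rewrite sa andbT.
      by apply: al => x [[]].
    by move=> y [_ nfy] /nfy.
  have [x Sx xa] : exists2 x, S x & ~ x <= a.
    apply: contrapT => nx; apply: nas; apply: sl => x Sx.
    by apply: contrapT => nxa; apply: nx; exists x.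
  apply: FCS (LA x _ (SC _ Sx)) (FCU _ _ Sx.2 (FC1 _ Di)) => y Ay.
  by apply: le_trans (Aa y Ay) _; apply: Cnle => //; exact: SC.
(* If [B] is nonempty, its infimum [b] lies strictly above [s]. Below [b], only [b] itself can be
   missed by [L s] and [f i], so [b] is in [S], a contradiction. *)
pose B := C `\` (L s `|` f i).
have BC : B `<=` C by move=> x [].
have [B0|/set0P Bn0] := eqVneq B set0.
  apply: FCS (FCU _ _ FCs (FC1 _ Di)) => x Cx.
  by apply: contrapT => nx; have : B x by []; rewrite B0.
have [b [Bb bl] cb] := Cinf B Bn0 BC.
have Cb : C b by exact: CclS cb.
have sb : s <= b.
  by apply: bl => x [Cx nx]; apply: Cnle => // xs; apply: nx; left.
have nbs : ~ b <= s.
  move=> bs; have := clf B i b Di cb; case.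
    by rewrite (_ : b = s)//; apply: le_anti; rewrite bs sb.
  by move=> y [_ nfy] fy; apply: nfy; right.
have [j Dj fb] := Cf b Cb.
case: nbs; apply: sS; split=> //.
apply: FCS (FCU _ _ (FCU _ _ FCs (FC1 _ Di)) (FC1 _ Dj)) => y [Cy /= yb].
have [|nLf] := pselect ((L s `|` f i) y); first by left.
by right; rewrite (_ : y = b)//; apply: le_anti; rewrite yb Bb.
Qed.

Lemma chain_compact_complete :
  updown_closed X -> chain_compact X -> complete_tposet X.
Proof.
move=> hX Xco; split=> D D0 Ddir.
- have [||x|x|C Ctot||s [sD sl] cs] :=
      @directed_lub X (fun x y => x <= y) _ _ _ _ _ D D0.
  + by [].
  + by move=> y x z; exact: le_trans.
  + exact: (hX x).1.
  + exact: (hX x).2.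
  + exact: Xco.
  + by move=> x y Dx Dy; have [z [Dz xz yz]] := Ddir x y Dx Dy; exists z.
  + by exists s.
- have [||x|x|C Ctot||s [sD sl] cs] :=
      @directed_lub X (fun x y => y <= x) _ _ _ _ _ D D0.
  + by [].
  + by move=> y x z xy yz; exact: le_trans yz xy.
  + exact: (hX x).2.
  + exact: (hX x).1.
  + by apply: Xco => x y Cx Cy; have [] := Ctot x y Cx Cy; [right|left].
  + by move=> x y Dx Dy; have [z [Dz xz yz]] := Ddir x y Dx Dy; exists z.
  + by exists s.
Qed.

End Completeness.

Theorem theorem4p3 (d : Order.disp_t) (X : POrderedTopological.type d)
    (hX : updown_closed X) : complete_tposet X <-> chain_compact X.
Proof.
by split; [exact: complete_chain_compact|exact: chain_compact_complete].
Qed.
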